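(* The square of the area of a triangle is one-quarter the quadrance of the base times the quadrance of the corresponding altitude. That is, let $A_1,A_2,A_3$ be the vertices of a triangle in the Euclidean plane $\mathbb{R}^2$, take any side as base, let $Q$ be the quadrance between the two endpoints of the base, let $F$ be the foot of the perpendicular from the opposite vertex to the line through the base, and let $H$ be the quadrance between that opposite vertex and $F$. Then $$\mathrm{area}^{2}=\frac{Q\times H}{4},$$ where $\mathrm{area}$ is the area of the triangle.
   Context: The quadrance between points $A=[x_1,y_1]$ and $B=[x_2,y_2]$ of the real Euclidean plane is $Q(A,B)=(x_2-x_1)^2+(y_2-y_1)^2$. The quadrance of a line segment is the quadrance between its endpoints. A triangle is given by three non-collinear points. The altitude corresponding to a base is the segment from the opposite vertex to the foot of the perpendicular from that vertex to the line containing the base. *)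

(* Defs.v *)
From HB Require Import structures.
From mathcomp Require Import all_boot all_order all_algebra.
From mathcomp Require Import all_classical all_reals all_analysis.
From mathcomp Require Import ring lra.

Set Implicit Arguments.
Unset Strict Implicit.
Unset Printing Implicit Defensive.

Import Order.TTheory GRing.Theory Num.Theory.
Local Open Scope classical_set_scope.
Local Open Scope ring_scope.

Definition quadrance (R : realType) (A B : R * R) : R :=
  (B.1 - A.1) ^+ 2 + (B.2 - A.2) ^+ 2.

(* A line only when P <> Q; it degenerates to the point P otherwise. *)
Definition line_through (R : realType) (P Q : R * R) : set (R * R) :=
  [set X | exists t : R,
     X = (P.1 + t * (Q.1 - P.1), P.2 + t * (Q.2 - P.2))].

Definition collinear (R : realType) (A : 'I_3 -> R * R) : Prop :=
  exists P Q : R * R, P <> Q /\ forall i, line_through P Q (A i).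

Definition is_foot (R : realType) (P Q C F : R * R) : Prop :=
  line_through P Q F /\
  (C.1 - F.1) * (Q.1 - P.1) + (C.2 - F.2) * (Q.2 - P.2) = 0.

(* Non-degenerate base lines have exactly one foot, so quantifying over all F
   with [is_foot P Q C F] is neither vacuous nor ambiguous. *)
Lemma is_foot_exists_unique (R : realType) (P Q C : R * R) :
  P <> Q -> exists! F, is_foot P Q C F.
Proof.
case: P Q C => [p1 p2] [q1 q2] [c1 c2] PQ.
have d0 : (q1 - p1) ^+ 2 + (q2 - p2) ^+ 2 != 0.
  apply/eqP => /eqP; rewrite paddr_eq0 ?sqr_ge0// !sqrf_eq0 !subr_eq0.
  by move=> /andP[/eqP e1 /eqP e2]; apply: PQ; rewrite e1 e2.
pose t := ((c1 - p1) * (q1 - p1) + (c2 - p2) * (q2 - p2)) /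
          ((q1 - p1) ^+ 2 + (q2 - p2) ^+ 2).
exists (p1 + t * (q1 - p1), p2 + t * (q2 - p2)); split.
  by split; [exists t | rewrite /= /t; field].
move=> _ [[s ->]] /= ort.
suff -> : t = s by [].
by apply: (mulIf d0); rewrite /t mulfVK//; apply/eqP; rewrite -subr_eq0 -ort;
  apply/eqP; ring.
Qed.

(* The closed triangle with vertices A, i.e. their convex hull, described by
   barycentric coordinates. *)
Definition triangle (R : realType) (A : 'I_3 -> R * R) : set (R * R) :=
  [set X | exists w : 'I_3 -> R,
     [/\ forall i, 0 <= w i, \sum_i w i = 1 &
         X = (\sum_i w i * (A i).1, \sum_i w i * (A i).2)]].

(* Area is planar Lebesgue measure, a priori an extended real. *)
Definition area (R : realType) (S : set (R * R)) : \bar R :=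
  ((@lebesgue_measure R \x @lebesgue_measure R) S)%E.

(* Main.v *)
Require Import Defs.
From mathcomp Require Import all_boot all_order all_algebra.
From mathcomp Require Import all_classical all_reals all_analysis.
From mathcomp Require Import measurable_realfun.
From mathcomp Require Import ring lra.
Import Order.TTheory GRing.Theory Num.Theory.
Import numFieldNormedType.Exports.
Local Open Scope classical_set_scope.
Local Open Scope ring_scope.

(** The square of the area of a triangle PQS and a quarter of the base quadrance
    times the altitude quadrance are both a quarter of the square of the cross
    product of PQ and PS.

    On the algebraic side ([cross_sqr_foot]), the cross product does not change
    when P is replaced by the foot F of the altitude, because F lies on the line
    PQ; as FS is orthogonal to PQ, Lagrange's identity, which says that
    cross ^ 2 + dot ^ 2 is the product of the quadrances, reduces to
    cross ^ 2 = Q * H.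

    On the measure side ([area_hull3]), the product measure is the integral over
    x of the length of the vertical section at x. Sort the vertices by abscissa.
    To the left of the middle vertex the section is cut out by the two sides
    that leave the leftmost vertex, so its length is proportional to the distance
    to that vertex; to the right of the middle vertex the same happens with the
    rightmost vertex ([lebesgue_measure_xsection_hull3]). The section length is
    a tent function of height |cross| / width over a base of length width,
    with integral |cross| / 2. The three abscissae of the vertices are
    negligible, which disposes of vertical sides. *)

(** * Triangles as hulls of three points *)

Definition cross {R : realType} (P Q S : R * R) : R :=
  (Q.1 - P.1) * (S.2 - P.2) - (Q.2 - P.2) * (S.1 - P.1).

(** Eliminating the weight of P from the barycentric coordinates leaves two free
    parameters; this treats P as an apex from which the two sides start. *)
Definition hull3 {R : realType} (P Q S : R * R) : set (R * R) :=
  [set X | exists b c, [/\ 0 <= b, 0 <= c, b + c <= 1 &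
     X = (P.1 + b * (Q.1 - P.1) + c * (S.1 - P.1),
          P.2 + b * (Q.2 - P.2) + c * (S.2 - P.2))]].

Lemma hull3_swap {R : realType} (P Q S : R * R) : hull3 P Q S = hull3 P S Q.
Proof.
suff h (Q' S' : R * R) : hull3 P Q' S' `<=` hull3 P S' Q'.
  by apply/seteqP; split; exact: h.
move=> X [b [c [b0 c0 bc ->]]].
exists c, b; split => //; first by rewrite addrC.
by congr pair; rewrite addrAC.
Qed.

Lemma hull3_rot {R : realType} (P Q S : R * R) : hull3 P Q S = hull3 Q S P.
Proof.
have h (P' Q' S' : R * R) : hull3 P' Q' S' `<=` hull3 Q' S' P'.
  move=> X [b [c [b0 c0 bc ->]]]; exists c, (1 - b - c).
  by split => //; [lra | lra | congr pair; ring].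
by apply/seteqP; split => //; apply: subset_trans (h _ _ _) (h _ _ _).
Qed.

(** * Vertical sections *)

(** Indexing a segment by a convex weight avoids deciding which endpoint is the
    lower one, which for the section of a triangle depends on its orientation. *)
Lemma lebesgue_measure_segment {R : realType} (p q : R) :
  (@lebesgue_measure R)
    [set y | exists2 l, 0 <= l <= 1 & y = l * p + (1 - l) * q] =
  `|p - q|%:E.
Proof.
wlog pq : p q / p <= q.
  move=> h; have [/h//|/ltW/h e] := leP p q.
  rewrite distrC -e; congr (lebesgue_measure _).
  by apply/seteqP; split => y [l l01 ->]; exists (1 - l); (lra || ring).
rewrite (_ : [set _ | _] = `[p, q]%classic).
  rewrite lebesgue_measure_itv/= lte_fin.
  case: ltP => [pq'|qp]; first by rewrite distrC ger0_norm ?subr_ge0// EFinB.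
  by rewrite (le_anti (introT andP (conj pq qp))) subrr normr0.
apply/seteqP; split => y /=.
  move=> [l /andP[l0 l1] ->]; rewrite in_itv/=; nra.
rewrite in_itv/= => /andP[py yq].
have [e|d] := eqVneq p q.
  by exists 0; [rewrite lexx ler01 | rewrite mul0r; lra].
have d0 : 0 < q - p by rewrite subr_gt0 lt_neqAle d.
exists ((q - y) / (q - p)).
  by rewrite divr_ge0 ?subr_ge0 //= ler_pdivrMr// mul1r; lra.
by field; rewrite gt_eqF.
Qed.

(** The hypotheses say that x lies strictly between the abscissa of the apex P
    and that of each of Q and S, on either side of P. The vertical line at x then
    meets both sides PQ and PS, at the fractions s and t of these sides, and the
    section is the segment between the two intersection points. *)
Lemma lebesgue_measure_xsection_hull3 {R : realType} (P Q S : R * R) (x : R) :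
  0 < (x - P.1) * (Q.1 - x) -> 0 < (x - P.1) * (S.1 - x) ->
  (@lebesgue_measure R) (xsection (hull3 P Q S) x) =
  `|cross P Q S * (x - P.1) / ((Q.1 - P.1) * (S.1 - P.1))|%:E.
Proof.
move=> hQ hS.
have xP : x - P.1 != 0 by apply: contraTneq hQ => ->; rewrite mul0r ltxx.
have QP : 0 < (x - P.1) * (Q.1 - P.1) by nra.
have SP : 0 < (x - P.1) * (S.1 - P.1) by nra.
have QP0 : Q.1 - P.1 != 0 by apply: contraTneq QP => ->; rewrite mulr0 ltxx.
have SP0 : S.1 - P.1 != 0 by apply: contraTneq SP => ->; rewrite mulr0 ltxx.
have divs (u v : R) : 0 < u * v -> 0 <= v / u.
  by move=> uv; rewrite -(pmulr_rge0 _ uv); have -> : u * v * (v / u) = v ^+ 2;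
   [field; apply: contraTneq uv => ->; rewrite mul0r ltxx|exact: sqr_ge0].
pose s := (x - P.1) / (Q.1 - P.1).
pose t := (x - P.1) / (S.1 - P.1).
have s01 : 0 <= s <= 1.
  rewrite divs 1?mulrC//= -subr_ge0.
  have -> : 1 - s = (Q.1 - x) / (x - P.1) * s by rewrite /s; field; apply/andP.
  by rewrite mulr_ge0 ?divs// mulrC.
have t01 : 0 <= t <= 1.
  rewrite divs 1?mulrC//= -subr_ge0.
  have -> : 1 - t = (S.1 - x) / (x - P.1) * t by rewrite /t; field; apply/andP.
  by rewrite mulr_ge0 ?divs// mulrC.
rewrite (_ : xsection _ _ = [set y | exists2 l, 0 <= l <= 1 &
    y = l * (P.2 + s * (Q.2 - P.2)) + (1 - l) * (P.2 + t * (S.2 - P.2))]).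
  rewrite lebesgue_measure_segment -normrN; congr (`|_|%:E).
  by rewrite /cross /s /t; field; apply/andP.
apply/seteqP; split => y.
  move/xsectionP => [b [c [b0 c0 bc [ex ->]]]].
  (* The weight of the point on PQ is b / s; e says that the complementary weight
     is c / t, which is the constraint that the abscissa is x. *)
  have e : 1 - b * ((Q.1 - P.1) / (x - P.1)) = c * ((S.1 - P.1) / (x - P.1)).
    apply: (mulIf xP).
    have -> : (1 - b * ((Q.1 - P.1) / (x - P.1))) * (x - P.1) =
              x - P.1 - b * (Q.1 - P.1) by field.
    by rewrite -mulrA divfK// {1}ex; ring.
  exists (b * ((Q.1 - P.1) / (x - P.1))).
    by rewrite mulr_ge0 ?divs// -subr_ge0 e mulr_ge0 ?divs.
  rewrite e /s /t.
  have -> : P.2 + b * (Q.2 - P.2) + c * (S.2 - P.2) =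
    P.2 * (b * ((Q.1 - P.1) / (x - P.1)) +
           (1 - b * ((Q.1 - P.1) / (x - P.1)))) +
    b * (Q.2 - P.2) + c * (S.2 - P.2) by ring.
  by rewrite e; field; apply/and3P.
move=> [l l01 ->]; apply/xsectionP.
exists (l * s), ((1 - l) * t); split; [nra|nra|nra|].
by congr pair; [rewrite /s /t; field; apply/andP | ring].
Qed.

Lemma triangle_hull3 {R : realType} (A : 'I_3 -> R * R) {i j k : 'I_3} :
  uniq [:: i; j; k] -> triangle A = hull3 (A i) (A j) (A k).
Proof.
move=> u.
have sum3 (w : 'I_3 -> R) : \sum_l w l = w i + w j + w k.
  have e : [:: i; j; k] =i index_enum 'I_3.
    apply: (uniq_min_size u _ _).2 => [l _|]; first exact: mem_index_enum.
    by rewrite [index_enum _]unlock -enumT size_enum_ord.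
  rewrite -(perm_big _ (uniq_perm u (index_enum_uniq _) e)).
  by rewrite !big_cons big_nil /= addr0 addrA.
move: u => /= /and3P[]; rewrite !inE negb_or => /andP[ij ik] jk _.
apply/seteqP; split => X.
  move=> [w [w0]]; rewrite !sum3 => w1 ->.
  have e : w i = 1 - w j - w k by lra.
  exists (w j), (w k); split; [exact: w0|exact: w0| |].
    by have := w0 i; lra.
  by congr pair; rewrite e; ring.
move=> [b [c [b0 c0 bc ->]]].
exists (fun l => if l == i then 1 - b - c else if l == j then b else c).
rewrite !sum3 !eqxx (eq_sym j) (negbTE ij) (eq_sym k) (negbTE ik).
rewrite (eq_sym k) (negbTE jk); split.
- by move=> l; case: ifP => _; [lra|case: ifP].
- by ring.
- by congr pair; ring.
Qed.

(** * Integration of the section length *)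

Lemma integral_linear {R : realType} (p r a b : R) : a <= b ->
  (\int[@lebesgue_measure R]_(x in `]a, b[) (p * (x - r))%:E)%E =
  (p * ((b - r) ^+ 2 - (a - r) ^+ 2) / 2)%:E.
Proof.
rewrite le_eqVlt => /predU1P[->|ab].
  by rewrite set_itvE integral_set0 subrr mulr0 mul0r.
have cf : continuous (fun x : R => p * (x - r)).
  move=> x; apply: cvgM; first exact: cvg_cst.
  by apply: cvgB; [exact: cvg_id|exact: cvg_cst].
have df (x : R) : is_derive x 1 (fun x => p / 2 * (x - r) ^+ 2) (p * (x - r)).
  apply: is_derive_eq; rewrite /GRing.scale/=; by field.
have cF : continuous (fun x : R => p / 2 * (x - r) ^+ 2).
  move=> x; apply/differentiable_continuous/derivable1_diffP.
  exact: ex_derive.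
rewrite -(@integral_itv_bndoo _ _ _ _ true false); last first.
  apply/measurable_EFinP; apply: measurable_funTS.
  exact: continuous_measurable_fun.
rewrite (@continuous_FTC2 _ _ (fun x => p / 2 * (x - r) ^+ 2))//.
- by rewrite -EFinB; congr EFin; field.
- exact: continuous_subspaceT.
- split.
  + by move=> x _; apply: ex_derive.
  + by apply: cvg_at_right_filter; exact: cF.
  + by apply: cvg_at_left_filter; exact: cF.
- by move=> x _; rewrite derive1E; apply: derive_val.
Qed.

(** The three end points are negligible and points are measurable, so the open
    pieces suffice; for the section length of a triangle this spares the abscissae
    of the vertices, where a side may be vertical. *)
Lemma ge0_integral_itv_split {R : realType} (f : R -> \bar R) (a b c : R) :
  a <= b -> b <= c -> (forall x, 0 <= f x)%E ->
  measurable_fun `]a, b[ f -> measurable_fun `]b, c[ f ->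
  (\int[@lebesgue_measure R]_(x in `[a, c]) f x =
   \int[@lebesgue_measure R]_(x in `]a, b[) f x +
   \int[@lebesgue_measure R]_(x in `]b, c[) f x)%E.
Proof.
move=> ab bc f0 mab mbc.
have mab' : measurable_fun `[a, b[ f.
  have [/= lt_ab|/= ba] := ltP a b.
    exact/emeasurable_fun_itv_obnd_cbndP.
  by rewrite set_itv_ge -?leNgt//; exact: measurable_fun_set0.
have mbc' : measurable_fun `[b, c] f.
  by apply/emeasurable_fun_itv_bndo_bndcP/emeasurable_fun_itv_obnd_cbndP.
rewrite (@itv_bndbnd_setU _ _ _ (BLeft b))// ge0_integral_setU//.
- by rewrite !integral_itv_bndoo.
- exact/measurable_funU.
- apply/disj_setPS => x [] /=; rewrite !in_itv/=.
  by move=> /andP[_ xb] /andP[/(lt_le_trans xb)]; rewrite ltxx.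
Qed.

(** Both sides are symmetric in the vertices, so these may be sorted by abscissa;
    the tent splits into two pieces at the middle vertex. Collinear vertices fit
    in: the tent has height 0, and vertices on one vertical line give an integral
    over a single point. *)
Lemma area_hull3 {R : realType} (P Q S : R * R) :
  area (hull3 P Q S) = (`|cross P Q S| / 2)%:E.
Proof.
wlog /andP[PQ QS] : P Q S / (P.1 <= Q.1) && (Q.1 <= S.1).
  have swap : `|cross P S Q| = `|cross P Q S|.
    by rewrite -normrN; congr `|_|; rewrite /cross; ring.
  have rot (P' Q' S' : R * R) : cross P' Q' S' = cross Q' S' P'.
    by rewrite /cross; ring.
  move=> h; have [PQ|/ltW QP] := leP P.1 Q.1; have [QS|/ltW SQ] := leP Q.1 S.1.
  - by apply: h; rewrite PQ.
  - have [PS|/ltW SP] := leP P.1 S.1.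
    + by rewrite hull3_swap -swap h// PS.
    + by rewrite -hull3_rot -rot h// SP.
  - have [PS|/ltW SP] := leP P.1 S.1.
    + by rewrite hull3_swap hull3_rot hull3_rot -swap rot rot h// QP.
    + by rewrite hull3_rot rot h// QS.
  - by rewrite hull3_swap hull3_rot -swap rot h// SQ.
(* The height of the tent; 0, by division by 0, if all abscissae agree. *)
pose K := `|cross P Q S| / (S.1 - P.1).
pose h (x : R) : \bar R := lebesgue_measure (xsection (hull3 P Q S) x).
have hL x : x \in `]P.1, Q.1[ -> h x = (K / (Q.1 - P.1) * (x - P.1))%:E.
  rewrite in_itv/= => /andP[Px xQ].
  rewrite /h lebesgue_measure_xsection_hull3; [|nra|nra].
  rewrite 2!normrM normfV normrM !(@gtr0_norm _ (_ - P.1)); [|lra..].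
  by congr EFin; rewrite /K; field; rewrite !gt_eqF; lra.
have hR x : x \in `]Q.1, S.1[ -> h x = (K / (Q.1 - S.1) * (x - S.1))%:E.
  rewrite in_itv/= => /andP[Qx xS].
  rewrite /h -hull3_rot lebesgue_measure_xsection_hull3; [|nra|nra].
  rewrite 2!normrM normfV normrM !(@ltr0_norm _ (_ - S.1)); [|lra..].
  rewrite (_ : cross S P Q = cross P Q S); last by rewrite /cross; ring.
  by congr EFin; rewrite /K; field; apply/and3P; split; apply/eqP => e; lra.
have mlin (D : set R) p r : measurable_fun D (fun x => (p * (x - r))%:E).
  apply/measurable_EFinP; apply: measurable_funTS.
  apply: measurable_funM; first exact: measurable_cst.
  by apply: measurable_funB; [exact: measurable_id|exact: measurable_cst].
have mL : measurable_fun `]P.1, Q.1[ h.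
  by apply: eq_measurable_fun (mlin _ _ _) => x; rewrite inE => /hL ->.
have mR : measurable_fun `]Q.1, S.1[ h.
  by apply: eq_measurable_fun (mlin _ _ _) => x; rewrite inE => /hR ->.
have -> : area (hull3 P Q S) =
    (\int[@lebesgue_measure R]_(x in `[P.1, S.1]) h x)%E.
  rewrite [RHS]integral_mkcond; apply: eq_integral => x _ /=.
  rewrite patchE; case: ifPn => //; rewrite notin_setE/= in_itv/= => /negP PxS.
  rewrite (_ : xsection _ x = set0) ?measure0//.
  apply/seteqP; split => // y /xsectionP[b [c [b0 c0 bc [ex _]]]].
  by move: PxS; rewrite ex; apply: contraNP => _; nra.
rewrite (@ge0_integral_itv_split _ _ _ Q.1)//.
(* When u = 0 one of the two pieces is empty; the identity still holds. *)
have divsq (u : R) : K / u * u ^+ 2 = K * u.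
  by have [->|u0] := eqVneq u 0; [rewrite mulr0 expr0n mulr0|field].
have -> : (\int[@lebesgue_measure R]_(x in `]P.1, Q.1[) h x)%E =
    (K * (Q.1 - P.1) / 2)%:E.
  transitivity (K / (Q.1 - P.1) * ((Q.1 - P.1) ^+ 2 - (P.1 - P.1) ^+ 2) / 2)%:E.
    by rewrite -integral_linear//; apply: eq_integral => x; rewrite inE => /hL.
  by rewrite subrr expr0n/= subr0 divsq.
have -> : (\int[@lebesgue_measure R]_(x in `]Q.1, S.1[) h x)%E =
    (- (K * (Q.1 - S.1)) / 2)%:E.
  transitivity (K / (Q.1 - S.1) * ((S.1 - S.1) ^+ 2 - (Q.1 - S.1) ^+ 2) / 2)%:E.
    by rewrite -integral_linear//; apply: eq_integral => x; rewrite inE => /hR.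
  by rewrite subrr expr0n/= sub0r mulrN divsq.
rewrite -EFinD; congr EFin.
transitivity (K * (S.1 - P.1) / 2); first by field.
congr (_ / 2); rewrite /K; have [e|/divfK->//] := eqVneq (S.1 - P.1) 0.
rewrite e mulr0 /cross e; have -> : Q.1 = P.1 by lra.
by rewrite subrr mul0r mulr0 subr0 normr0.
Qed.

(** * Base and altitude *)

(** Moving P along the line PQ to the foot F leaves the cross product unchanged;
    the rest is Lagrange's identity with a vanishing dot product. *)
Lemma cross_sqr_foot {R : realType} (P Q C F : R * R) :
  is_foot P Q C F ->
  cross P Q C ^+ 2 = quadrance P Q * quadrance C F.
Proof.
move=> [[t eF] ort].
have -> : cross P Q C = (Q.1 - P.1) * (C.2 - F.2) - (Q.2 - P.2) * (C.1 - F.1).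
  by rewrite /cross eF/=; ring.
rewrite -[LHS]addr0 -[0](expr0n _ 2) -[in X in _ + X]ort /quadrance; ring.
Qed.

Theorem theorem2 (R : realType) (A : 'I_3 -> R * R) (i j k : 'I_3)
    (F : R * R) :
  ~ collinear A ->
  uniq [:: i; j; k] ->
  is_foot (A i) (A j) (A k) F ->
  (area (triangle A) ^+ 2 =
     (quadrance (A i) (A j) * quadrance (A k) F / 4)%:E)%E.
Proof.
move=> _ ijk /cross_sqr_foot QH.
rewrite (triangle_hull3 _ ijk) area_hull3 -EFin_expe -QH; congr EFin.
by rewrite expr_div_n real_normK ?num_real//; field.
Qed.
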